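(* Let $\tau>0$, $\varphi>0$, and $d_i\ge0$ for $i=1,\dots,N$ with $\sum_i d_i>0$ be fixed. For $\tilde\psi=(\tilde\psi_1,\dots,\tilde\psi_N)\in(0,\infty)^N$ let $\pi_A=\pi_A(\varphi,\tilde\psi)>0$ be the equilibrium premium, i.e. the unique positive solution of $\pi_A=\varphi D_A(\pi_A)$. In the limit $\tilde\psi_i\to\infty$ for all $i$ (i.e. $\min_i\tilde\psi_i\to\infty$), one has $\lambda_i^*(\pi_A)\to0$ for every $i$, $|D_A'(\pi_A)|\to0$, and the elasticity $$\frac{d\log\pi_A}{d\log\varphi}=\frac{1}{1+\varphi\,|D_A'(\pi_A)|}$$ converges to $1$. Consequently the gap $1-\frac{d\log\pi_A}{d\log\varphi}$ vanishes in this limit, and the elasticity $\frac{d\log\pi_A}{d\log\varphi}$ depends on the level of $\tilde\psi$ (it is not constant as a function of $\tilde\psi$).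
   Context: There are finitely many operators $i=1,\dots,N$ with expected compliance shortfalls $d_i\ge0$ and normalized access-cost parameters $\tilde\psi_i>0$; $\tau>0$ is the cycle length. For $\pi\ge0$ define $$\lambda_i^*(\pi)=\frac1\tau W\!\left(\frac{d_i\pi\tau^2}{\tilde\psi_i}\right),\qquad D_A(\pi)=\sum_i d_i e^{-\lambda_i^*(\pi)\tau},$$ where $W$ is the Lambert $W$ function on $[0,\infty)$, the inverse of $y\mapsto ye^y$ on $[0,\infty)$. Both depend on $\tilde\psi$. When $\sum_i d_i>0$, for each $\varphi>0$ the equation $\pi=\varphi D_A(\pi)$ has a unique positive solution, the equilibrium surrender-month return premium $\pi_A$, which depends on $(\varphi,\tilde\psi)$. $D_A'$ denotes the derivative of $D_A$ in $\pi$. The elasticity is $\frac{d\log\pi_A}{d\log\varphi}=\frac{\varphi}{\pi_A}\frac{\partial\pi_A}{\partial\varphi}$ with $d_i,\tilde\psi_i,\tau$ held fixed. *)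

(* Defs.v *)
From HB Require Import structures.
From mathcomp Require Export all_boot all_order all_algebra.
From mathcomp Require Export all_classical all_reals all_analysis.
Export numFieldNormedType.Exports.
Import Order.TTheory GRing.Theory Num.Theory.

Set Implicit Arguments.
Unset Strict Implicit.
Unset Printing Implicit Defensive.

Local Open Scope classical_set_scope.
Local Open Scope ring_scope.

(* Inverse of y |-> y e^y on [0, +oo); junk value 0 for x < 0. *)
Definition lambertW (R : realType) (x : R) : R :=
  xget 0 [set y : R | 0 <= y /\ y * expR y = x].

Definition optimal_rate (R : realType) (tau di psii p : R) : R :=
  tau^-1 * lambertW (di * p * tau ^+ 2 / psii).

Definition aggregate_shortfall (R : realType) (N : nat) (tau : R)
    (d psi : 'I_N -> R) (p : R) : R :=
  \sum_(i < N) d i * expR (- (optimal_rate tau (d i) (psi i) p * tau)).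

Definition is_equilibrium (R : realType) (N : nat) (tau : R)
    (d psi : 'I_N -> R) (phi p : R) : Prop :=
  0 < p /\ p = phi * aggregate_shortfall tau d psi p.

Definition equilibrium_premium (R : realType) (N : nat) (tau : R)
    (d : 'I_N -> R) (phi : R) (psi : 'I_N -> R) : R :=
  xget 0 [set p : R | is_equilibrium tau d psi phi p].

Definition elasticity (R : realType) (N : nat) (tau : R)
    (d : 'I_N -> R) (phi : R) (psi : 'I_N -> R) : R :=
  phi / equilibrium_premium tau d phi psi
  * derive1 (fun f : R => equilibrium_premium tau d f psi) phi.

(* The filter "min_i psi_i --> +oo". *)
Definition all_pinfty (R : realType) (N : nat) : set_system ('I_N -> R) :=
  filter_from [set: R] (fun M : R => [set psi | forall i, M < psi i]).
Arguments all_pinfty : clear implicits.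

Global Instance all_pinfty_proper (R : realType) (N : nat) :
  ProperFilter (all_pinfty R N).
Proof.
apply: filter_from_proper => [|M _].
  apply: filter_fromT_filter => [|M M']; first by exists 0.
  exists (Num.max M M') => psi /= H.
  by split=> i; move: (H i); rewrite gt_max => /andP[].
by exists (fun=> M + 1) => i /=; rewrite ltrDl ltr01.
Qed.

Section WellDefined.
Variable R : realType.
Implicit Types x y p phi tau : R.

Let xexp_lt x y : 0 <= x -> x < y -> x * expR x < y * expR y.
Proof.
by move=> x0 xy; apply: ltr_pM => //; rewrite ?expR_ge0 ?ltr_expR.
Qed.

Let xexp_inj x y : 0 <= x -> 0 <= y -> x * expR x = y * expR y -> x = y.
Proof.
move=> x0 y0 E; case: (ltgtP x y) => // h.
  by have := xexp_lt x0 h; rewrite E ltxx.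
by have := xexp_lt y0 h; rewrite E ltxx.
Qed.

Lemma lambertWP x : 0 <= x ->
  0 <= lambertW x /\ lambertW x * expR (lambertW x) = x.
Proof.
move=> x0; apply: (@xgetPex _ 0 [set y : R | 0 <= y /\ y * expR y = x]).
have c : {within `[0, x], continuous (fun y : R => y * expR y)}.
  apply: continuous_subspaceT => y; apply: cvgM; first exact: cvg_id.
  exact: continuous_expR.
have [|y] := IVT x0 c (v := x).
  rewrite mul0r ge_min x0 /= le_max; apply/orP; right.
  rewrite ler_peMr // (le_trans _ (expR_ge1Dx x)) //.
  by rewrite lerDl.
by rewrite in_itv /= => /andP[y0 _] E; exists y.
Qed.

Lemma lambertWK y : 0 <= y -> lambertW (y * expR y) = y.
Proof.
move=> y0; have [|w0 E] := @lambertWP (y * expR y).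
  by rewrite mulr_ge0 ?expR_ge0.
exact: xexp_inj.
Qed.

Lemma lambertW_le x y : 0 <= x -> x <= y -> lambertW x <= lambertW y.
Proof.
move=> x0 xy; have [a0 aE] := lambertWP x0.
have [b0 bE] := lambertWP (le_trans x0 xy).
rewrite leNgt; apply/negP => h.
by have := xexp_lt b0 h; rewrite aE bE ltNge xy.
Qed.

Lemma lambertW_continuous x : 0 < x -> {for x, continuous (@lambertW R)}.
Proof.
move=> x0; have [w0 wE] := lambertWP (ltW x0).
have wp : 0 < lambertW x.
  rewrite lt_neqAle w0 andbT; apply/negP => /eqP h.
  by move: wE x0; rewrite -h mul0r => <-; rewrite ltxx.
have D : is_derive (lambertW x) 1 (fun y : R => y * expR y)
    (lambertW x *: expR (lambertW x) + expR (lambertW x) *: 1).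
  exact: is_deriveM.
rewrite -[x in {for x, _}]wE; apply: differentiable_continuous.
apply/derivable1_diffP.
have [] // := @is_derive_inverse R (fun y : R => y * expR y) (@lambertW R) _ _ _ _ D _.
- near=> z; apply: lambertWK; apply: ltW; near: z; exact: lt_nbhsr.
- near=> z; apply: cvgM; first exact: cvg_id.
  exact: continuous_expR.
- rewrite gt_eqF // addr_gt0 //.
    by rewrite /GRing.scale /= mulr_gt0 ?expR_gt0.
  by rewrite /GRing.scale /= mulr1 expR_gt0.
Unshelve. all: by end_near. Qed.

Lemma equilibrium_premiumP (N : nat) tau (d psi : 'I_N -> R) phi :
  0 < tau -> 0 < phi -> (forall i, 0 <= d i) -> 0 < \sum_(i < N) d i ->
  (forall i, 0 < psi i) ->
  is_equilibrium tau d psi phi (equilibrium_premium tau d phi psi) /\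
  forall p, is_equilibrium tau d psi phi p ->
    p = equilibrium_premium tau d phi psi.
Proof.
move=> t0 f0 d0 D0 psi0.
pose A := aggregate_shortfall tau d psi.
have arg_ge0 i p : 0 <= p -> 0 <= d i * p * tau ^+ 2 / psi i.
  by move=> p0; rewrite divr_ge0 ?(ltW (psi0 _)) // !mulr_ge0 // ltW.
have A_le p q : 0 <= p -> p <= q -> A q <= A p.
  move=> p0 pq; apply: ler_sum => i _; apply: ler_wpM2l => //.
  rewrite ler_expR lerN2 ler_pM2r // /optimal_rate ler_pM2l ?invr_gt0 //.
  apply: lambertW_le; first exact: arg_ge0.
  rewrite ler_pM2r ?invr_gt0 // ler_pM2r ?exprn_gt0 //.
  exact: ler_wpM2l.
have A_gt0 p : 0 < A p.
  have [i /negP di] : exists i, ~ (d i <= 0).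
    apply/existsNP => h; move: D0; rewrite ltNge => /negP; apply.
    by apply: sumr_le0 => i _.
  rewrite /A /aggregate_shortfall (bigD1 i) //= ltr_pwDl //.
    by rewrite mulr_gt0 ?expR_gt0 // ltNge.
  by apply: sumr_ge0 => j _; rewrite mulr_ge0 ?expR_ge0.
have uniq_eq p q : is_equilibrium tau d psi phi p ->
    is_equilibrium tau d psi phi q -> p = q.
  have H u v : is_equilibrium tau d psi phi u ->
      is_equilibrium tau d psi phi v -> v <= u.
    move=> [u0 uE] [v0 vE]; rewrite leNgt; apply/negP => uv.
    have := uv; rewrite uE vE ltr_pM2l // ltNge.
    by rewrite (A_le u v (ltW u0) (ltW uv)).
  by move=> hp hq; apply/eqP; rewrite eq_le !H.
suff [p hp] : exists p, is_equilibrium tau d psi phi p.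
  have h := @xgetPex _ 0 [set p : R | is_equilibrium tau d psi phi p]
    (ex_intro _ p hp).
  by split=> // q hq; exact: uniq_eq.
pose a := Num.min 1 (phi * A 1).
have a0 : 0 < a by rewrite lt_min ltr01 mulr_gt0.
have ca : a <= phi * A a.
  apply: (@le_trans _ _ (phi * A 1)); first by rewrite ge_min lexx orbT.
  by rewrite ler_pM2l // A_le ?(ltW a0) // ge_min lexx.
pose b := a + phi * A a.
have ab : a <= b by rewrite lerDl ltW // mulr_gt0.
have cb : phi * A b <= b.
  apply: (@le_trans _ _ (phi * A a)); first by rewrite ler_pM2l // A_le // ltW.
  by rewrite lerDr ltW.
have Ac p : 0 < p -> {for p, continuous A}.
  move=> p0; apply: cvg_big => [|i _]; first exact: add_continuous.
  apply: cvgM; first exact: cvg_cst.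
  apply: continuous_comp; last exact: continuous_expR.
  apply: cvgN; apply: cvgM; last exact: cvg_cst.
  apply: cvgM; first exact: cvg_cst.
  have [di|di] := eqVneq (d i) 0.
    rewrite di (_ : (fun _ => _) = fun=> lambertW 0); last first.
      by apply/funext => z; rewrite !mul0r.
    by rewrite !mul0r; exact: cvg_cst.
  apply: (@continuous_comp _ _ _ (fun z => d i * z * tau ^+ 2 / psi i)).
    apply: cvgM; last exact: cvg_cst.
    apply: cvgM; last exact: cvg_cst.
    by apply: cvgM; [exact: cvg_cst|exact: cvg_id].
  apply: lambertW_continuous.
  by rewrite !mulr_gt0 ?invr_gt0 ?exprn_gt0 // lt_neqAle eq_sym di d0.
have c : {within `[a, b], continuous (fun p : R => p - phi * A p)}.
  apply: continuous_in_subspaceT => p; rewrite inE /= in_itv /= => /andP[ap _].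
  apply: cvgB; first exact: cvg_id.
  by apply: cvgM; [exact: cvg_cst|apply: Ac; exact: lt_le_trans ap].
have [|p] := IVT ab c (v := 0).
  by rewrite ge_min subr_le0 ca /= le_max !subr_ge0 cb orbT.
rewrite in_itv /= => /andP[ap _] /eqP; rewrite subr_eq0 => /eqP E.
by exists p; split => //; exact: lt_le_trans ap.
Qed.

End WellDefined.

(* Main.v *)
Require Import Defs.
From mathcomp Require Import ring.
Set Implicit Arguments.
Unset Strict Implicit.
Unset Printing Implicit Defensive.
Import Order.TTheory GRing.Theory Num.Theory.
Local Open Scope classical_set_scope.
Local Open Scope ring_scope.

(** Since [W' = exp (- W) / (1 + W)], the derivative of the shortfall is
    [D_A' = - B] with [B] a nonnegative sum over [i] that is at most
    [\sum_i d_i ^ 2 * tau ^ 2 / psi_i]; hence [B] tends to 0.  The premium is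
    the inverse of [p |-> p / D_A p], and differentiating this inverse gives the
    elasticity [1 / (1 + phi * B)], which is less than 1 for every [psi] and
    tends to 1, so it cannot be constant. *)

(** * Bounds and derivative of the Lambert function *)

Lemma lambertW_le_id (R : realType) (x : R) : 0 <= x -> lambertW x <= x.
Proof.
move=> x0; have [w0 wE] := lambertWP x0.
rewrite -[leRHS]wE ler_peMr // (le_trans _ (expR_ge1Dx _)) //.
by rewrite lerDl.
Qed.

Lemma lambertW_gt0 (R : realType) (x : R) : 0 < x -> 0 < lambertW x.
Proof.
move=> x0; have [w0 wE] := lambertWP (ltW x0).
rewrite lt_neqAle w0 andbT; apply/negP => /eqP h.
by move: wE x0; rewrite -h mul0r => <-; rewrite ltxx.
Qed.

(** Inverse function rule for [y * expR y], whose derivative at [y = lambertW x] is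
    [(1 + y) * expR y]. With [0 < x] the point [lambertW x] is interior to the half-line where
    [lambertW] is a left inverse. *)
Lemma is_derive_lambertW (R : realType) (x : R) : 0 < x ->
  is_derive x 1 (@lambertW R) (expR (- lambertW x) / (1 + lambertW x)).
Proof.
move=> x0; have [w0 wE] := lambertWP (ltW x0).
have wp := lambertW_gt0 x0.
have D : is_derive (lambertW x) 1 (fun y : R => y * expR y)
    ((1 + lambertW x) * expR (lambertW x)).
  have H : is_derive (lambertW x) 1 (fun y : R => y * expR y)
    (lambertW x *: expR (lambertW x) + expR (lambertW x) *: 1).
    exact: is_deriveM.
  by apply: is_derive_eq H _; rewrite /GRing.scale /=; ring.
(* The point becomes the image of [lambertW x] and the slope becomes a reciprocal, as the inverse
   rule expects. *)
rewrite -[x in is_derive x]wE expRN -invfM [expR _ * _]mulrC.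
apply: (is_derive_inverse _ _ D).
- near=> z; apply: lambertWK; apply: ltW; near: z; exact: lt_nbhsr.
- near=> z; apply: cvgM; first exact: cvg_id.
  exact: continuous_expR.
- by rewrite gt_eqF // mulr_gt0 ?expR_gt0 // addr_gt0.
Unshelve. all: by end_near. Qed.

(** A positive sum of the [d i] forces some [d i] to be positive, and that index makes the second
    sum strict. *)
Lemma sum_pos_gt0 (R : realType) (N : nat) (d F : 'I_N -> R) :
  (forall i, 0 <= d i) -> 0 < \sum_(i < N) d i ->
  (forall i, 0 <= F i) -> (forall i, 0 < d i -> 0 < F i) ->
  0 < \sum_(i < N) F i.
Proof.
move=> d0 dgt0 F0 F1; rewrite lt_neqAle sumr_ge0 // andbT eq_sym psumr_neq0 //.
move: dgt0; rewrite lt_neqAle eq_sym psumr_neq0 // => /andP[/hasP[i ii di] _].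
by apply/hasP; exists i => //; exact: F1.
Qed.

(** This is [- D_A']. One factor [expR (- w)] comes from the shortfall itself and the other from
    [W' = expR (- w) / (1 + w)], hence the square. *)
Definition shortfall_slope (R : realType) (N : nat) (tau : R)
    (d psi : 'I_N -> R) (p : R) : R :=
  \sum_(i < N) let w := lambertW (d i * tau ^+ 2 / psi i * p) in
    d i * (d i * tau ^+ 2 / psi i) * (expR (- w) ^+ 2 / (1 + w)).

(** * The aggregate shortfall and its slope, for fixed positive costs *)

Section Shortfall.
Variables (R : realType) (N : nat) (tau : R) (d psi : 'I_N -> R).
Hypotheses (tau0 : 0 < tau) (d0 : forall i, 0 <= d i)
  (psi0 : forall i, 0 < psi i).

Let coef_ge0 i : 0 <= d i * tau ^+ 2 / psi i.
Proof. by rewrite divr_ge0 ?(ltW (psi0 i)) // mulr_ge0 // ltW ?exprn_gt0. Qed.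

Let optimal_rateE i (p : R) :
  optimal_rate tau (d i) (psi i) p =
  tau^-1 * lambertW (d i * tau ^+ 2 / psi i * p).
Proof. by rewrite /optimal_rate; congr (_ * lambertW _); ring. Qed.

Lemma optimal_rate_ge0 i (p : R) : 0 <= p -> 0 <= optimal_rate tau (d i) (psi i) p.
Proof.
move=> p0; have [w0 _] := lambertWP (mulr_ge0 (coef_ge0 i) p0).
by rewrite optimal_rateE mulr_ge0 ?invr_ge0 ?(ltW tau0).
Qed.

Lemma optimal_rate_le i (p : R) : 0 <= p ->
  optimal_rate tau (d i) (psi i) p <= d i * p * tau / psi i.
Proof.
move=> p0; rewrite optimal_rateE mulrC ler_pdivrMr //.
rewrite (_ : d i * p * tau / psi i * tau = d i * tau ^+ 2 / psi i * p); last by ring.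
by rewrite lambertW_le_id // mulr_ge0.
Qed.

(** The factors [tau] and [tau^-1] cancel; a sum of functions is the shape needed to differentiate
    term by term. *)
Lemma aggregate_shortfallE :
  aggregate_shortfall tau d psi =
  \sum_(i < N) (fun p => d i * expR (- lambertW (d i * tau ^+ 2 / psi i * p))).
Proof.
apply/funext => p; rewrite fct_sumE; apply: eq_bigr => i _.
by rewrite optimal_rateE mulrAC mulVf ?gt_eqF // mul1r.
Qed.

Lemma aggregate_shortfall_le (p : R) : 0 <= p ->
  aggregate_shortfall tau d psi p <= \sum_(i < N) d i.
Proof.
move=> p0; apply: ler_sum => i _; rewrite ler_piMr //.
by rewrite -expR0 ler_expR oppr_le0 mulr_ge0 ?(ltW tau0) // optimal_rate_ge0.
Qed.

Lemma aggregate_shortfall_gt0 (p : R) : 0 < \sum_(i < N) d i ->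
  0 < aggregate_shortfall tau d psi p.
Proof.
move=> dgt0; apply: (sum_pos_gt0 d0 dgt0) => i; first by rewrite mulr_ge0 ?expR_ge0.
by move=> di; rewrite mulr_gt0 ?expR_gt0.
Qed.

Lemma is_derive_aggregate_shortfall (p : R) : 0 < p ->
  is_derive p 1 (aggregate_shortfall tau d psi)
    (- shortfall_slope tau d psi p).
Proof.
move=> p0; rewrite aggregate_shortfallE /shortfall_slope -sumrN.
apply: is_derive_sum => i.
have [di|di] := eqVneq (d i) 0.
  rewrite di !mul0r oppr0 (_ : (fun _ => _) = cst 0); first exact: is_derive_cst.
  by apply/funext => z; rewrite !mul0r.
set a := d i * _ / _.
have a0 : 0 < a.
  by rewrite !mulr_gt0 ?invr_gt0 ?exprn_gt0 // lt_neqAle eq_sym di d0.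
have ap0 : 0 < a * p by rewrite mulr_gt0.
have DW := is_derive_lambertW ap0.
have Da : is_derive p 1 (fun z : R => a * z) a.
  have H : is_derive p 1 (a *: id : R -> R) (a *: 1) by exact: is_deriveZ.
  by apply: is_derive_eq H _; rewrite /GRing.scale /= mulr1.
have D1 := is_derive1_comp DW Da.
have D2 := is_derive1_comp (is_derive_expR _) (is_deriveN D1).
have D3 := is_deriveZ (d i) D2.
apply: is_derive_eq D3 _.
rewrite /GRing.scale /=; ring.
Qed.

Lemma shortfall_slope_ge0 (p : R) : 0 <= p -> 0 <= shortfall_slope tau d psi p.
Proof.
move=> p0; apply: sumr_ge0 => i _ /=.
have [w0 _] := lambertWP (mulr_ge0 (coef_ge0 i) p0).
by rewrite mulr_ge0 ?(mulr_ge0 (d0 i)) //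
    divr_ge0 ?addr_ge0 ?exprn_ge0 ?expR_ge0.
Qed.

(** Strictness puts the elasticity strictly below 1 at each positive [psi], which refutes
    constancy. *)
Lemma shortfall_slope_gt0 (p : R) : 0 <= p -> 0 < \sum_(i < N) d i ->
  0 < shortfall_slope tau d psi p.
Proof.
move=> p0 dgt0; apply: (sum_pos_gt0 d0 dgt0) => i /=;
  have [w0 _] := lambertWP (mulr_ge0 (coef_ge0 i) p0).
  by rewrite mulr_ge0 ?(mulr_ge0 (d0 i)) //
    divr_ge0 ?addr_ge0 ?exprn_ge0 ?expR_ge0.
by move=> di; rewrite !mulr_gt0 ?exprn_gt0 ?expR_gt0 ?invr_gt0 ?ltr_pwDl.
Qed.

(** Each factor [expR (- w) ^+ 2 / (1 + w)] is at most 1 since [0 <= w]. The bound is free of [p],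
    so it applies at the moving equilibrium. *)
Lemma shortfall_slope_le (p : R) : 0 <= p ->
  shortfall_slope tau d psi p <= \sum_(i < N) d i * (d i * tau ^+ 2 / psi i).
Proof.
move=> p0; apply: ler_sum => i _ /=.
have [w0 _] := lambertWP (mulr_ge0 (coef_ge0 i) p0).
rewrite ler_piMr ?(mulr_ge0 (d0 i)) // ler_pdivrMr ?mul1r; last by rewrite ltr_pwDl.
apply: (@le_trans _ _ 1); last by rewrite lerDl.
by rewrite exprn_ile1 ?expR_ge0 // -expR0 ler_expR oppr_le0.
Qed.

Lemma derive1_aggregate_shortfall (p : R) : 0 < p ->
  derive1 (aggregate_shortfall tau d psi) p = - shortfall_slope tau d psi p.
Proof.
by move=> /is_derive_aggregate_shortfall DA; rewrite derive1E derive_val.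
Qed.

(** * The equilibrium premium and its elasticity *)

Variable phi : R.
Hypotheses (phi0 : 0 < phi) (dgt0 : 0 < \sum_(i < N) d i).
Local Notation A := (aggregate_shortfall tau d psi).
Local Notation B := (shortfall_slope tau d psi).
Local Notation pi := (equilibrium_premium tau d phi psi).

Lemma equilibrium_premium_gt0 : 0 < pi.
Proof. by have [[]] := equilibrium_premiumP tau0 phi0 d0 dgt0 psi0. Qed.

Lemma equilibrium_premium_fixed : pi = phi * A pi.
Proof. by have [[]] := equilibrium_premiumP tau0 phi0 d0 dgt0 psi0. Qed.

(** A bound uniform in [psi], which keeps the premium under control in the limit. *)
Lemma equilibrium_premium_le : pi <= phi * \sum_(i < N) d i.
Proof.
rewrite equilibrium_premium_fixed ler_pM2l // aggregate_shortfall_le //.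
exact/ltW/equilibrium_premium_gt0.
Qed.

(** The map [p / A p] has derivative [1 / A p + p * B p / A p ^+ 2 > 0], and the premium as a
    function of [phi] inverts it. At [pi], substituting [pi = phi * A pi] simplifies the reciprocal
    of this derivative. *)
Lemma is_derive_equilibrium_premium :
  is_derive phi 1 (fun f => equilibrium_premium tau d f psi)
    (A pi / (1 + phi * B pi)).
Proof.
have pi0 := equilibrium_premium_gt0; have piE := equilibrium_premium_fixed.
have A0 p : 0 < A p by exact: aggregate_shortfall_gt0.
have B0 : 0 <= B pi by rewrite shortfall_slope_ge0 // ltW.
have Dg (p : R) : 0 < p -> is_derive p 1 (fun q => q / A q)
    (p * (A p ^- 2 * B p) + (A p)^-1).
  move=> p0; have DA := is_derive_aggregate_shortfall p0.
  have DV := is_deriveV (lt0r_neq0 (A0 p)) DA.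
  apply: is_derive_eq (is_deriveM (is_derive_id p 1) DV) _.
  by rewrite /GRing.scale /= mulr1 mulrNN.
have gE : pi / A pi = phi by rewrite [X in X / _]piE mulfK ?gt_eqF.
rewrite -[x in is_derive x]gE.
rewrite (_ : A pi / _ = (pi * (A pi ^- 2 * B pi) + (A pi)^-1)^-1); last first.
  rewrite [X in (X * _ + _)^-1]piE; field.
  by rewrite !gt_eqF // ltr_wpDl ?mulr_ge0 ?(ltW phi0).
have pi_near : \forall z \near pi, 0 < z by exact: lt_nbhsr.
apply: (is_derive_inverse _ _ (Dg _ pi0)).
(* Any [z > 0] is an equilibrium for the parameter [z / A z], so uniqueness identifies it with the
   premium there. *)
- near=> z; have z0 : 0 < z by near: z.
  have zA : 0 < z / A z by rewrite divr_gt0.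
  have [_ uniq] := equilibrium_premiumP tau0 zA d0 dgt0 psi0.
  by rewrite -(uniq z) //; split => //; rewrite divfK ?gt_eqF.
- near=> z; have z0 : 0 < z by near: z.
  apply/differentiable_continuous/derivable1_diffP.
  by have [] := Dg z z0.
- rewrite gt_eqF // ltr_wpDl ?invr_gt0 //.
  by rewrite (mulr_ge0 (ltW pi0)) // mulr_ge0 // invr_ge0 exprn_ge0 // ltW.
Unshelve. all: by end_near. Qed.

(** By the fixed-point equation [phi / pi = 1 / A pi], which cancels the numerator of the
    derivative. *)
Lemma elasticityE : elasticity tau d phi psi = 1 / (1 + phi * B pi).
Proof.
have := is_derive_equilibrium_premium => Dpi.
rewrite /elasticity derive1E derive_val.
rewrite [X in _ / X * _]equilibrium_premium_fixed.
have A0 : 0 < A pi by exact: aggregate_shortfall_gt0.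
field; rewrite !gt_eqF ?ltr_pwDl ?mulr_ge0 ?(ltW phi0) //.
by rewrite shortfall_slope_ge0 // ltW // equilibrium_premium_gt0.
Qed.

End Shortfall.

(** * Limits as all costs tend to infinity *)

Section PinftyLimit.
Variables (R : realType) (N : nat).

Lemma near_all_pinfty (M : R) :
  \forall psi \near all_pinfty R N, forall i, M < psi i.
Proof. by exists M. Qed.

Lemma cvg_all_pinftyV (i : 'I_N) :
  (psi i)^-1 @[psi --> all_pinfty R N] --> (0 : R).
Proof.
apply/gtr0_cvgV0; first by apply: filterS (near_all_pinfty 0) => psi.
by apply/cvgryPgt => M; apply: filterS (near_all_pinfty M) => psi.
Qed.

Variables (tau phi : R) (d : 'I_N -> R).
Hypotheses (tau0 : 0 < tau) (phi0 : 0 < phi) (d0 : forall i, 0 <= d i)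
  (dgt0 : 0 < \sum_(i < N) d i).

Lemma optimal_rate_cvg0 i :
  optimal_rate tau (d i) (psi i) (equilibrium_premium tau d phi psi)
    @[psi --> all_pinfty R N] --> (0 : R).
Proof.
(* The bound [lambertW x <= x] and the uniform bound on the premium give a rate of at most
   [C / psi i]. *)
pose C := d i * (phi * \sum_(i < N) d i) * tau.
apply: (@squeeze_cvgr _ _ _ _ (fun=> 0) (fun psi => C * (psi i)^-1)).
- apply: filterS (near_all_pinfty 0) => psi psi0.
  have pi0 := equilibrium_premium_gt0 tau0 d0 psi0 phi0 dgt0.
  rewrite optimal_rate_ge0 ?(ltW pi0) //=.
  apply: le_trans (optimal_rate_le tau0 d0 psi0 i (ltW pi0)) _.
  rewrite ler_pM2r ?invr_gt0 // ler_pM2r // ler_wpM2l //.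
  exact: equilibrium_premium_le.
- exact: cvg_cst.
- by rewrite -[0](mulr0 C); apply: cvgM (cvg_all_pinftyV i); exact: cvg_cst.
Qed.

Lemma shortfall_slope_cvg0 :
  shortfall_slope tau d psi (equilibrium_premium tau d phi psi)
    @[psi --> all_pinfty R N] --> (0 : R).
Proof.
apply: (@squeeze_cvgr _ _ _ _ (fun=> 0)
  (fun psi => \sum_(i < N) d i * (d i * tau ^+ 2 / psi i))).
- apply: filterS (near_all_pinfty 0) => psi psi0.
  have pi0 := equilibrium_premium_gt0 tau0 d0 psi0 phi0 dgt0.
  by rewrite shortfall_slope_ge0 ?shortfall_slope_le ?(ltW pi0).
- exact: cvg_cst.
- rewrite [X in _ --> X](_ : _ = \sum_(i < N) d i * (d i * tau ^+ 2 * 0));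
    last by rewrite big1 // => i _; rewrite !mulr0.
  apply: cvg_big => [|i _]; first exact: add_continuous.
  apply: cvgM; first exact: cvg_cst.
  by apply: cvgM (cvg_all_pinftyV i); exact: cvg_cst.
Qed.

Lemma elasticity_cvg1 :
  elasticity tau d phi psi @[psi --> all_pinfty R N] --> (1 : R).
Proof.
pose F psi := 1 / (1 + phi *
  shortfall_slope tau d psi (equilibrium_premium tau d phi psi)).
(* The closed form [F] is established only for positive [psi], which holds eventually along the
   filter. *)
apply: (@cvg_trans _ (F @ all_pinfty R N)).
  apply: near_eq_cvg; apply: filterS (near_all_pinfty 0) => psi psi0.
  by rewrite /F elasticityE.
have -> : 1 = 1 / (1 + phi * 0) :> R by rewrite mulr0 addr0 divr1.
apply: cvgM; first exact: cvg_cst.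
apply: cvgV; first by rewrite mulr0 addr0 oner_neq0.
apply: cvgD; first exact: cvg_cst.
by apply: cvgM shortfall_slope_cvg0; exact: cvg_cst.
Qed.

End PinftyLimit.

Theorem corollary2 (R : realType) (N : nat) (tau phi : R) (d : 'I_N -> R)
    (htau : 0 < tau) (hphi : 0 < phi) (hd : forall i, 0 <= d i)
    (hsum : 0 < \sum_(i < N) d i) :
  let D_A (psi : 'I_N -> R) := aggregate_shortfall tau d psi in
  let pi_A (psi : 'I_N -> R) := equilibrium_premium tau d phi psi in
  (forall i, optimal_rate tau (d i) (psi i) (pi_A psi)
     @[psi --> all_pinfty R N] --> (0 : R)) /\
  (`| derive1 (D_A psi) (pi_A psi) | @[psi --> all_pinfty R N] --> (0 : R)) /\
  (forall psi : 'I_N -> R, (forall i, 0 < psi i) ->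
     [/\ derivable (D_A psi) (pi_A psi) 1,
         derivable (fun f : R => equilibrium_premium tau d f psi) phi 1 &
         elasticity tau d phi psi
           = 1 / (1 + phi * `| derive1 (D_A psi) (pi_A psi) |)]) /\
  (elasticity tau d phi psi @[psi --> all_pinfty R N] --> (1 : R)) /\
  (1 - elasticity tau d phi psi @[psi --> all_pinfty R N] --> (0 : R)) /\
  (exists psi psi' : 'I_N -> R,
     [/\ forall i, 0 < psi i, forall i, 0 < psi' i &
         elasticity tau d phi psi <> elasticity tau d phi psi']).
Proof.
move=> D_A pi_A.
have pi0 psi : (forall i, 0 < psi i) -> 0 < pi_A psi.
  by move=> psi0; exact: equilibrium_premium_gt0.
have absE psi : (forall i, 0 < psi i) ->
    `|derive1 (D_A psi) (pi_A psi)| = shortfall_slope tau d psi (pi_A psi).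
  move=> psi0; rewrite derive1_aggregate_shortfall ?pi0 // normrN.
  by rewrite ger0_norm // shortfall_slope_ge0 // ltW ?pi0.
have el1 := elasticity_cvg1 htau hphi hd hsum.
split; first by move=> i; exact: optimal_rate_cvg0.
split.
  apply: cvg_trans (shortfall_slope_cvg0 htau hphi hd hsum).
  apply: near_eq_cvg; apply: filterS (near_all_pinfty N 0) => psi psi0.
  by rewrite absE.
split.
  move=> psi psi0; split.
  - by have [] := is_derive_aggregate_shortfall htau hd psi0 (pi0 _ psi0).
  - by have [] := is_derive_equilibrium_premium htau hd psi0 hphi hsum.
  - by rewrite absE // elasticityE.
split; first exact: el1.
split; first by rewrite -[0](subrr 1); apply: cvgB el1; exact: cvg_cst.
(* The elasticity is below 1 at this [psi1] but tends to 1, so it must exceed its value at [psi1]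
   somewhere. *)
pose psi1 : 'I_N -> R := fun=> 1.
have psi10 i : 0 < psi1 i by exact: ltr01.
have lt1 : elasticity tau d phi psi1 < 1.
  have B0 := shortfall_slope_gt0 htau hd psi10 (ltW (pi0 _ psi10)) hsum.
  by rewrite elasticityE // ltr_pdivrMr ?mul1r ?ltrDl ?addr_gt0 ?mulr_gt0.
have [psi2 [psi20 lt2]] : exists psi2 : 'I_N -> R, (forall i, 0 < psi2 i) /\
    elasticity tau d phi psi1 < elasticity tau d phi psi2.
  (* Properness of the filter turns two eventual properties, positivity and the strict inequality,
     into an actual witness. *)
  apply: (@filter_ex _ (all_pinfty R N)); apply: filterI.
    exact: near_all_pinfty.
  exact: (cvgr_gt _ el1).
exists psi1, psi2; split => // E; by rewrite E ltxx in lt2.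
Qed.
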